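(* One-object compact (dagger/inverse) categories are exactly commutative (involutive/inverse) monoids. That is: (i) if $M$ is a commutative monoid, then $M$, regarded as a one-object monoidal category (whose single object is the tensor unit, and whose tensor product and composition of morphisms are both the multiplication of $M$), is a compact category; if moreover $M$ is an involutive monoid it is a compact dagger category, and if $M$ is an inverse monoid it is a compact inverse category. (ii) Conversely, the monoid of endomorphisms of the unique object of a one-object compact category is commutative; if the category is a compact dagger category this monoid is a commutative involutive monoid, and if it is a compact inverse category this monoid is a commutative inverse monoid.
   Context: A compact category is a symmetric monoidal category in which every object $A$ has a dual: an object $A^*$ with morphisms $\eta_A\colon I\to A^*\otimes A$ and $\varepsilon_A\colon A\otimes A^*\to I$ such that, suppressing coherence isomorphisms, $(\varepsilon_A\otimes\mathrm{id}_A)\circ(\mathrm{id}_A\otimes\eta_A)=\mathrm{id}_A$ and $(\mathrm{id}_{A^*}\otimes\varepsilon_A)\circ(\eta_A\otimes\mathrm{id}_{A^*})=\mathrm{id}_{A^*}$. A dagger category is a category with an identity-on-objects contravariant involution $\dag$. A compact dagger category is a dagger category that is symmetric monoidal, with $(f\otimes g)^\dag=f^\dag\otimes g^\dag$ for all morphisms, all coherence isomorphisms inverted by their own daggers, and in which every object $A$ has a dual with $\varepsilon_A=\eta_A^\dag\circ\sigma$, where $\sigma$ is the swap map. An inverse category is a category in which every morphism $f\colon A\to B$ admits a unique $f^\dag\colon B\to A$ with $f=ff^\dag f$ and $f^\dag=f^\dag ff^\dag$. A compact inverse category is an inverse category that is a compact dagger category under the same dagger. An involutive monoid is a monoid with an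 anti-multiplicative involution $\dag$. An inverse monoid is a monoid in which every element $x$ has a unique $x^\dag$ with $x=xx^\dag x$ and $x^\dag=x^\dag xx^\dag$. *)

(* Defs.v *)
From mathcomp Require Import ssreflect ssrfun ssrbool.

Set Implicit Arguments.
Unset Strict Implicit.
Unset Printing Implicit Defensive.

(* Operations and axioms are kept apart: the [*_data] records carry no proofs,
   and each kind of category is a predicate on such data. *)

Declare Scope cat_scope.
Delimit Scope cat_scope with cat.

Reserved Notation "g ∘ f" (at level 40, left associativity).
Reserved Notation "f ⊗ g" (at level 35, no associativity).

Record category_data := CategoryData {
  ob : Type;
  hom : ob -> ob -> Type;
  idm : forall A, hom A A;
  compm : forall A B C, hom B C -> hom A B -> hom A C }.

Arguments idm {c} A.
Arguments compm {c A B C} g f.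

Notation "g ∘ f" := (compm g f) : cat_scope.
Local Open Scope cat_scope.

Record is_category (C : category_data) : Prop := {
  comp_idl : forall (A B : ob C) (f : hom A B), idm B ∘ f = f;
  comp_idr : forall (A B : ob C) (f : hom A B), f ∘ idm A = f;
  comp_assoc : forall (A B X Y : ob C)
      (h : hom X Y) (g : hom B X) (f : hom A B),
    h ∘ (g ∘ f) = (h ∘ g) ∘ f }.

Record symmon_data := SymmonData {
  symmon_cat :> category_data;
  tensor : ob symmon_cat -> ob symmon_cat -> ob symmon_cat;
  tensorm : forall A B X Y : ob symmon_cat,
    hom A B -> hom X Y -> hom (tensor A X) (tensor B Y);
  munit : ob symmon_cat;
  assoc : forall A B C : ob symmon_cat,
    hom (tensor (tensor A B) C) (tensor A (tensor B C));
  assoc_inv : forall A B C : ob symmon_cat,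
    hom (tensor A (tensor B C)) (tensor (tensor A B) C);
  lunit : forall A : ob symmon_cat, hom (tensor munit A) A;
  lunit_inv : forall A : ob symmon_cat, hom A (tensor munit A);
  runit : forall A : ob symmon_cat, hom (tensor A munit) A;
  runit_inv : forall A : ob symmon_cat, hom A (tensor A munit);
  swap : forall A B : ob symmon_cat, hom (tensor A B) (tensor B A) }.

Arguments tensor {s} A B.
Arguments tensorm {s A B X Y} f g.
Arguments munit {s}.
Arguments assoc {s} A B C.
Arguments assoc_inv {s} A B C.
Arguments lunit {s} A.
Arguments lunit_inv {s} A.
Arguments runit {s} A.
Arguments runit_inv {s} A.
Arguments swap {s} A B.

Notation "f ⊗ g" := (tensorm f g) : cat_scope.

Definition mutually_inverse (C : category_data) (A B : ob C)
    (f : hom A B) (g : hom B A) : Prop :=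
  g ∘ f = idm A /\ f ∘ g = idm B.

Record is_symmon (S : symmon_data) : Prop := {
  symmon_category : is_category S;
  tensor_id : forall A B : ob S, idm A ⊗ idm B = idm (tensor A B);
  tensor_comp : forall (A B C X Y Z : ob S)
      (g : hom B C) (f : hom A B) (k : hom Y Z) (h : hom X Y),
    (g ∘ f) ⊗ (k ∘ h) = (g ⊗ k) ∘ (f ⊗ h);
  assoc_iso : forall A B C : ob S,
    mutually_inverse (assoc A B C) (assoc_inv A B C);
  lunit_iso : forall A : ob S, mutually_inverse (lunit A) (lunit_inv A);
  runit_iso : forall A : ob S, mutually_inverse (runit A) (runit_inv A);
  assoc_nat : forall (A A' B B' C C' : ob S)
      (f : hom A A') (g : hom B B') (h : hom C C'),
    assoc A' B' C' ∘ ((f ⊗ g) ⊗ h) = (f ⊗ (g ⊗ h)) ∘ assoc A B C;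
  lunit_nat : forall (A B : ob S) (f : hom A B),
    lunit B ∘ (idm munit ⊗ f) = f ∘ lunit A;
  runit_nat : forall (A B : ob S) (f : hom A B),
    runit B ∘ (f ⊗ idm munit) = f ∘ runit A;
  swap_nat : forall (A A' B B' : ob S) (f : hom A A') (g : hom B B'),
    swap A' B' ∘ (f ⊗ g) = (g ⊗ f) ∘ swap A B;
  pentagon : forall A B C D : ob S,
    (idm A ⊗ assoc B C D) ∘ assoc A (tensor B C) D ∘ (assoc A B C ⊗ idm D)
    = assoc A B (tensor C D) ∘ assoc (tensor A B) C D;
  triangle : forall A B : ob S,
    (idm A ⊗ lunit B) ∘ assoc A munit B = runit A ⊗ idm B;
  swap_swap : forall A B : ob S, swap B A ∘ swap A B = idm (tensor A B);
  hexagon : forall A B C : ob S,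
    assoc B C A ∘ swap A (tensor B C) ∘ assoc A B C
    = (idm B ⊗ swap A C) ∘ assoc B A C ∘ (swap A B ⊗ idm C) }.

(* The two snake equations, with the coherence isomorphisms written out. *)
Definition is_dual (S : symmon_data) (A A' : ob S)
    (eta : hom munit (tensor A' A)) (eps : hom (tensor A A') munit) : Prop :=
  lunit A ∘ (eps ⊗ idm A) ∘ assoc_inv A A' A ∘ (idm A ⊗ eta) ∘ runit_inv A
    = idm A
  /\
  runit A' ∘ (idm A' ⊗ eps) ∘ assoc A' A A' ∘ (eta ⊗ idm A') ∘ lunit_inv A'
    = idm A'.

Record is_compact (S : symmon_data) : Prop := {
  compact_symmon : is_symmon S;
  compact_dual : forall A : ob S, exists (A' : ob S)
      (eta : hom munit (tensor A' A)) (eps : hom (tensor A A') munit),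
    is_dual eta eps }.

Definition dagger_data (C : category_data) :=
  forall A B : ob C, hom A B -> hom B A.

Record is_dagger (C : category_data) (dag : dagger_data C) : Prop := {
  dagger_category : is_category C;
  dagger_id : forall A : ob C, dag A A (idm A) = idm A;
  dagger_comp : forall (A B X : ob C) (g : hom B X) (f : hom A B),
    dag A X (g ∘ f) = dag A B f ∘ dag B X g;
  dagger_invol : forall (A B : ob C) (f : hom A B), dag B A (dag A B f) = f }.

Record is_compact_dagger (S : symmon_data) (dag : dagger_data S) : Prop := {
  compact_dagger_dagger : is_dagger dag;
  compact_dagger_symmon : is_symmon S;
  dagger_tensor : forall (A B X Y : ob S) (f : hom A B) (g : hom X Y),
    dag _ _ (f ⊗ g) = dag _ _ f ⊗ dag _ _ g;
  dagger_assoc : forall A B C : ob S, dag _ _ (assoc A B C) = assoc_inv A B C;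
  dagger_lunit : forall A : ob S, dag _ _ (lunit A) = lunit_inv A;
  dagger_runit : forall A : ob S, dag _ _ (runit A) = runit_inv A;
  dagger_swap : forall A B : ob S,
    mutually_inverse (swap A B) (dag _ _ (swap A B));
  dagger_dual : forall A : ob S, exists (A' : ob S)
      (eta : hom munit (tensor A' A)) (eps : hom (tensor A A') munit),
    is_dual eta eps /\ eps = dag _ _ eta ∘ swap A A' }.

Definition generalized_inverse (C : category_data) (A B : ob C)
    (f : hom A B) (g : hom B A) : Prop :=
  f = f ∘ g ∘ f /\ g = g ∘ f ∘ g.

Record is_inverse_category (C : category_data) : Prop := {
  inverse_category : is_category C;
  inverse_unique : forall (A B : ob C) (f : hom A B),
    exists! g : hom B A, generalized_inverse f g }.

(* By [inverse_unique], [dag] can only be the dagger of the inverse category. *)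
Definition is_compact_inverse (S : symmon_data) : Prop :=
  is_inverse_category S /\
  exists dag : dagger_data S,
    (forall (A B : ob S) (f : hom A B), generalized_inverse f (dag A B f)) /\
    is_compact_dagger dag.

(* MathComp's [monoidType] and [starMonoidType] require a choice operator on
   the carrier, which hom-types lack; hence these predicates over any type. *)
Section Monoids.
Variables (M : Type) (mul : M -> M -> M) (one : M).

Record is_monoid : Prop := {
  monoid_assoc : associative mul;
  monoid_1l : left_id one mul;
  monoid_1r : right_id one mul }.

Record is_involutive_monoid (dag : M -> M) : Prop := {
  involutive_is_monoid : is_monoid;
  involutive_dag : involutive dag;
  involutive_anti : {morph dag : x y / mul x y >-> mul y x} }.

Record is_inverse_monoid : Prop := {
  inverse_is_monoid : is_monoid;
  inverse_monoid_unique : forall x, exists! y,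
    x = mul (mul x y) x /\ y = mul (mul y x) y }.

Definition monoid_category : category_data :=
  @CategoryData unit (fun _ _ => M) (fun _ => one) (fun _ _ _ => mul).

Definition monoid_symmon : symmon_data :=
  @SymmonData monoid_category
    (fun _ _ => tt) (fun _ _ _ _ => mul) tt
    (fun _ _ _ => one) (fun _ _ _ => one)
    (fun _ => one) (fun _ => one) (fun _ => one) (fun _ => one)
    (fun _ _ => one).

End Monoids.

(* Main.v *)
Require Import Defs.
From mathcomp Require Import ssreflect ssrfun ssrbool.
From Stdlib Require Import IndefiniteDescription.

Set Implicit Arguments.
Unset Strict Implicit.
Unset Printing Implicit Defensive.

(** From monoids to categories: every structural isomorphism of
    [monoid_symmon mul one] is [one], so the coherence axioms hold by the unit
    laws, and [one] serves as unit and counit of a duality.  Commutativity is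
    what makes the multiplication a bifunctor (the interchange law
    [(g f) (k h) = (g k) (f h)], [tensor_comp]) and the swap natural.  With an
    involution [dag], commutativity also turns anti-multiplicativity into
    [dag (f ⊗ g) = dag f ⊗ dag g].  For an inverse monoid the pseudo-inverse is
    such an involution: the product of pseudo-inverses is a pseudo-inverse of
    the product, because all factors commute, and uniqueness does the rest
    ([pseudoinverse_involutive]).

    From categories to monoids: the only axiom of the monoid that is not an
    instance of a category axiom is commutativity.  The unique object is the
    tensor unit, and the endomorphisms of the unit of a monoidal category
    commute ([unit_endo_comm]) by an Eckmann-Hilton argument. *)

Local Open Scope cat_scope.

(** * Commutative monoids as one-object categories *)

Lemma monoid_is_category (M : Type) (mul : M -> M -> M) (one : M) :
  is_monoid mul one -> is_category (monoid_category mul one).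
Proof.
move=> [mulA mul1x mulx1]; split=> /= *; [exact: mul1x | exact: mulx1 |].
exact: mulA.
Qed.

Lemma mul_medial (M : Type) (mul : M -> M -> M) :
    associative mul -> commutative mul ->
  forall a b c d, mul (mul a b) (mul c d) = mul (mul a c) (mul b d).
Proof.
by move=> mulA mulC a b c d; rewrite -!mulA (mulA b) (mulC b) -(mulA c).
Qed.

Lemma monoid_is_symmon (M : Type) (mul : M -> M -> M) (one : M) :
    is_monoid mul one -> commutative mul ->
  is_symmon (monoid_symmon mul one).
Proof.
move=> monM mulC; have [mulA mul1x mulx1] := monM.
have iso1 (A : unit) : @mutually_inverse (monoid_category mul one) A A one one.
  by split; rewrite /= mul1x.
split=> /= *; rewrite ?mul1x ?mulx1 //; exact: mul_medial.
Qed.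

Lemma monoid_is_dual (M : Type) (mul : M -> M -> M) (one : M) :
    is_monoid mul one ->
  @is_dual (monoid_symmon mul one) tt tt one one.
Proof. by move=> [_ mul1x _]; split; rewrite /= !mul1x. Qed.

Lemma monoid_is_compact (M : Type) (mul : M -> M -> M) (one : M) :
    is_monoid mul one -> commutative mul ->
  is_compact (monoid_symmon mul one).
Proof.
move=> monM mulC; split; first exact: monoid_is_symmon.
by case; exists tt, one, one; apply: monoid_is_dual.
Qed.

Lemma involutive_monoid_dag1 (M : Type) (mul : M -> M -> M) (one : M)
    (dag : M -> M) :
  is_involutive_monoid mul one dag -> dag one = one.
Proof.
move=> [[_ mul1x mulx1] dagK dagM].
by rewrite -{2}(dagK one) -{2}(mul1x (dag one)) dagM dagK mul1x.
Qed.

Lemma monoid_is_compact_dagger (M : Type) (mul : M -> M -> M) (one : M)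
    (dag : M -> M) :
    commutative mul -> is_involutive_monoid mul one dag ->
  @is_compact_dagger (monoid_symmon mul one) (fun _ _ => dag).
Proof.
move=> mulC invM; have dag1 := involutive_monoid_dag1 invM.
have [monM dagK dagM] := invM; have [_ mul1x _] := monM.
split=> //=.
- by split=> //=; apply: monoid_is_category.
- exact: monoid_is_symmon.
- by move=> *; rewrite dagM mulC.
- by move=> _ _; split; rewrite /= dag1 mul1x.
- case; exists tt, one, one; split; first exact: monoid_is_dual.
  by rewrite dag1 mul1x.
Qed.

(** Each identity holds because its two sides are pseudo-inverses of the same
    element: pseudo-inversion is a symmetric relation, and by commutativity it
    is stable under products. *)
Lemma pseudoinverse_involutive (M : Type) (mul : M -> M -> M) (one : M)
    (dag : M -> M) :
    is_inverse_monoid mul one -> commutative mul ->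
    (forall x, x = mul (mul x (dag x)) x /\
               dag x = mul (mul (dag x) x) (dag x)) ->
  is_involutive_monoid mul one dag.
Proof.
move=> [monM exu] mulC dagP; have [mulA _ _] := monM.
have dag_uniq x y :
    x = mul (mul x y) x -> y = mul (mul y x) y -> dag x = y.
  move=> xyx yxy; have [z [_ z_uniq]] := exu x.
  by rewrite -(z_uniq _ (dagP x)); apply: z_uniq.
split=> // [x | x y]; first by have [? ?] := dagP x; apply: dag_uniq.
have [xP dxP] := dagP x; have [yP dyP] := dagP y.
rewrite (mulC (dag y)); have medial := mul_medial mulA mulC.
apply: dag_uniq.
- by rewrite (medial x) (medial (mul x (dag x))) -xP -yP.
- by rewrite (medial (dag x)) (medial (mul (dag x) x)) -dxP -dyP.
Qed.

Lemma monoid_is_compact_inverse (M : Type) (mul : M -> M -> M) (one : M) :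
    commutative mul -> is_inverse_monoid mul one ->
  is_compact_inverse (monoid_symmon mul one).
Proof.
move=> mulC invM; have [monM exu] := invM; split.
  by split=> [|[] [] x]; [exact: monoid_is_category | exact: exu].
have [|dag dagP] := functional_choice
    (fun x y => x = mul (mul x y) x /\ y = mul (mul y x) y).
  by move=> x; have [y [yP _]] := exu x; exists y.
exists (fun _ _ => dag); split=> [[] [] x|]; first exact: dagP.
apply: (monoid_is_compact_dagger mulC).
exact: (pseudoinverse_involutive invM mulC dagP).
Qed.

(** * Endomorphisms in one-object categories *)

Lemma category_end_monoid (C : category_data) (A : ob C) :
  is_category C -> is_monoid (@compm C A A A) (idm A).
Proof.
move=> [id1x idx1 compA].
by split=> [f g h | f | f]; [exact: compA | exact: id1x | exact: idx1].
Qed.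

(** By naturality of the unitors, [f ⊗ id] and [id ⊗ g] are the conjugates of
    [f] and [g] by the right and the left unitor of the unit object, and they
    commute by interchange.  Hence [f] commutes with the conjugate of [g] by the
    automorphism [u = runit ∘ lunit_inv]; conjugation by [u] is surjective, so
    [f] commutes with everything.  This way the coherence theorem
    [lunit = runit] at the unit object, that is [u = id], can be avoided. *)
Lemma unit_endo_comm (S : symmon_data) :
  is_symmon S -> commutative (@compm S munit munit munit).
Proof.
move=> symS; have [id1x idx1 compA] := symmon_category symS.
have [lVl llV] := lunit_iso symS munit.
have [rVr rrV] := runit_iso symS munit.
set l := lunit munit in lVl llV; set l' := lunit_inv munit in lVl llV.
set r := runit munit in rVr rrV; set r' := runit_inv munit in rVr rrV.
have conj_comm (f g : hom munit munit) :
    f ∘ (r ∘ l' ∘ g ∘ l ∘ r') = (r ∘ l' ∘ g ∘ l ∘ r') ∘ f.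
  have fE : f ⊗ idm munit = r' ∘ f ∘ r.
    by rewrite -compA -(runit_nat symS) compA rVr id1x.
  have gE : idm munit ⊗ g = l' ∘ g ∘ l.
    by rewrite -compA -(lunit_nat symS) compA lVl id1x.
  have : (f ⊗ idm munit) ∘ (idm munit ⊗ g) = (idm munit ⊗ g) ∘ (f ⊗ idm munit).
    by rewrite -!(tensor_comp symS) !id1x !idx1.
  rewrite fE gE => /(congr1 (fun k => r ∘ k ∘ r')).
  by rewrite !compA rrV id1x -(compA _ _ _ _ _ r r') rrV idx1.
move=> f g; have := conj_comm f (l ∘ r' ∘ g ∘ r ∘ l').
have -> // : r ∘ l' ∘ (l ∘ r' ∘ g ∘ r ∘ l') ∘ l ∘ r' = g.
rewrite !compA -(compA _ _ _ _ r) lVl idx1 rrV id1x.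
by rewrite -(compA _ _ _ _ _ l') lVl idx1 -compA rrV idx1.
Qed.

Lemma one_object_end_comm (S : symmon_data) (A : ob S) :
    (forall B : ob S, B = A) -> is_symmon S ->
  commutative (@compm S A A A).
Proof. by move=> /(_ munit) <-; apply: unit_endo_comm. Qed.

Theorem proposition9 :
  (forall (M : Type) (mul : M -> M -> M) (one : M),
     is_monoid mul one -> commutative mul ->
     is_compact (monoid_symmon mul one)
     /\ (forall dag : M -> M, is_involutive_monoid mul one dag ->
           @is_compact_dagger (monoid_symmon mul one) (fun _ _ => dag))
     /\ (is_inverse_monoid mul one ->
           is_compact_inverse (monoid_symmon mul one)))
  /\
  (forall (S : symmon_data) (A : ob S), (forall B : ob S, B = A) ->
     (is_compact S ->
        is_monoid (@compm S A A A) (idm A) /\ commutative (@compm S A A A))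
     /\ (forall dag : dagger_data S, is_compact_dagger dag ->
           is_involutive_monoid (@compm S A A A) (idm A) (dag A A)
           /\ commutative (@compm S A A A))
     /\ (is_compact_inverse S ->
           is_inverse_monoid (@compm S A A A) (idm A)
           /\ commutative (@compm S A A A))).
Proof.
split=> [M mul one monM mulC | S A oneA].
  split; first exact: monoid_is_compact.
  by split=> [dag|]; [exact: monoid_is_compact_dagger
                     | exact: monoid_is_compact_inverse].
split; [|split].
- move=> [symS _]; split; last exact: one_object_end_comm.
  exact: (category_end_monoid A (symmon_category symS)).
- move=> dag [[catS _ dagM dagK] symS _ _ _ _ _ _].
  split; last exact: one_object_end_comm.
  by split=> [|f|f g]; [exact: category_end_monoid | exact: dagK | exact: dagM].
- move=> [[catS exu] [dag [_ /compact_dagger_symmon symS]]].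
  split; last exact: one_object_end_comm.
  by split=> [|f]; [exact: category_end_monoid | exact: exu].
Qed.
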